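(* Let $K$ be a positive integer and let $\mu$ be a Radon measure on $\mathbb{R}$ with positive Fourier dimension. Then for $\mu$-almost all real numbers $x$, the set $$\Big\{\sum_{n=1}^\infty \frac{[((n-1)!)^K n^{K-j} x]}{(n!)^K} \;:\; j\in\{2,\dots,K\}\Big\}\ \cup\ \Big\{\sum_{n=1}^\infty (-1)^n \frac{[((n-1)!)^K n^{K-1} x\,[\log_2 n]]}{(n!)^K},\ 1\Big\}$$ consists of numbers that are linearly independent over $\mathbb{Q}$.
   Context: For a real number $y$, $[y]$ denotes the integer part of $y$ and $\log_2$ is the base-$2$ logarithm. For a Radon measure $\mu$ on $\mathbb{R}$, its Fourier transform is $\hat{\mu}(t)=\int_{-\infty}^\infty e^{-2\pi i x t}\,d\mu(x)$, and its Fourier dimension is $\dim_F(\mu)=\sup\{\eta\ge 0 : |\hat{\mu}(t)|\ll (1+|t|)^{-\eta/2}\}$. ''Positive Fourier dimension'' means $\dim_F(\mu)>0$. (When $K=1$ the first set is empty.) *)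

(* Defs.v *)
From HB Require Import structures.
From mathcomp Require Import all_boot all_order all_algebra.
From mathcomp Require Import complex.
From mathcomp Require Import all_classical all_reals all_analysis.

Set Implicit Arguments.
Unset Strict Implicit.
Unset Printing Implicit Defensive.

Import Order.TTheory GRing.Theory Num.Theory.
Import numFieldNormedType.Exports.

Local Open Scope classical_set_scope.
Local Open Scope ring_scope.

(* [measurableTypeR R] is [R] with its Borel sigma-algebra. *)
Definition radon (R : realType)
    (mu : {measure set (measurableTypeR R) -> \bar R}) : Prop :=
  (forall C : set R, compact C -> (mu C < +oo)%E) /\
  (forall A : set (measurableTypeR R), measurable A ->
     mu A = ereal_sup [set mu C | C in [set C : set R | compact C /\ C `<=` A]]).

Definition cintegrable (R : realType)
    (mu : {measure set (measurableTypeR R) -> \bar R}) (f : R -> R[i]) : Prop :=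
  mu.-integrable [set: measurableTypeR R] (fun x => (complex.Re (f x))%:E) /\
  mu.-integrable [set: measurableTypeR R] (fun x => (complex.Im (f x))%:E).

Definition cintegral (R : realType)
    (mu : {measure set (measurableTypeR R) -> \bar R}) (f : R -> R[i]) : R[i] :=
  Complex (\int[mu]_x complex.Re (f x)) (\int[mu]_x complex.Im (f x)).

(* e^{i theta} *)
Definition expi (R : realType) (theta : R) : R[i] :=
  Complex (cos theta) (sin theta).

Definition fourier (R : realType)
    (mu : {measure set (measurableTypeR R) -> \bar R}) (t : R) : R[i] :=
  cintegral mu (fun x => expi (- (2 * pi * x * t))).

(* The library integral of a non-integrable function is a default value, so the
   existence of the Fourier transform has to be required explicitly; at t = 0 it
   says that mu is finite. *)
Definition fourier_decay (R : realType)
    (mu : {measure set (measurableTypeR R) -> \bar R}) (eta : R) : Prop :=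
  (forall t : R, cintegrable mu (fun x => expi (- (2 * pi * x * t)))) /\
  (exists C : R, forall t : R,
     ComplexField.Normc.normc (fourier mu t) <= C * (1 + `|t|) `^ (- (eta / 2))).

Definition fourier_dim (R : realType)
    (mu : {measure set (measurableTypeR R) -> \bar R}) : \bar R :=
  ereal_sup [set eta%:E | eta in [set eta : R | 0 <= eta /\ fourier_decay mu eta]].

Definition ipart (R : realType) (y : R) : R := (Num.floor y)%:~R.

Definition log2 (R : realType) (y : R) : R := ln y / ln 2.

(* sum_{n >= 1} u n *)
Definition sum_from1 (R : realType) (u : nat -> R) : R :=
  limn (fun N => \sum_(1 <= n < N.+1) u n).

Definition zeta_like (R : realType) (K : nat) (x : R) (j : nat) : R :=
  sum_from1 (fun n =>
    ipart ((n.-1`!)%:R ^+ K * n%:R ^+ (K - j) * x) / (n`!)%:R ^+ K).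

Definition gamma_like (R : realType) (K : nat) (x : R) : R :=
  sum_from1 (fun n =>
    (-1) ^+ n *
    (ipart ((n.-1`!)%:R ^+ K * n%:R ^+ K.-1 * x * ipart (log2 n%:R))
       / (n`!)%:R ^+ K)).

(* R is infinite dimensional over rat, so the library's [free] does not apply. *)
Definition lin_indep_rat (R : realType) (s : seq R) : Prop :=
  forall c : 'I_(size s) -> rat,
    \sum_(i < size s) ratr (c i) * s`_i = 0 -> forall i, c i = 0.

(* Main.v *)
Require Import Defs.
From mathcomp Require Import all_boot all_order all_algebra.
From mathcomp Require Import all_classical all_reals all_analysis.
From mathcomp Require Import complex measurable_realfun ring lra zify.

Import Order.TTheory GRing.Theory Num.Theory.
Import numFieldNormedType.Exports.

Local Open Scope classical_set_scope.
Local Open Scope ring_scope.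

(** A rational relation between the numbers of the family amounts, for some
    integers d_k not all zero, to an integer combination z_n of the n^k
    (k < K - 1) and of (-1)^n n^(K-1) [log_2 n] such that, with B_N the partial
    sums of the convergent series of general term z_n / n^K, of sum B, the
    products x (N!)^K (B - B_N) are at distance O(1/N) from the integers:
    truncating at N and multiplying by (N!)^K leaves an integer, and each floor
    costs less than 1. The frequencies l_N = (N!)^K (B - B_N) are unbounded,
    since l_{N+1} = (N+1)^K l_N - (N!)^K z_{N+1} would otherwise force the
    integers z_N to vanish for large N, hence all d_k to be zero. Finally, when
    the Fourier transform of mu tends to 0 and l_N is unbounded, the set of x
    such that cos (2 pi l_N x) >= 1/2 for all N is null: along a sparse
    subsequence the cosines are almost orthogonal, so the second moment of the
    sum of M of them is o(M^2). There are countably many relations. *)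

(** * Second moments of cosine sums under Fourier decay *)

Section fourier_decay_moments.
Context {R : realType} (mu : {measure set (measurableTypeR R) -> \bar R}).

Local Notation wave t := (fun x : measurableTypeR R => cos (2 * pi * x * t) : R).

Lemma Rintegral_sum (I : Type) (s : seq I)
    (f : I -> measurableTypeR R -> R) :
  (forall i, mu.-integrable setT (EFin \o f i)) ->
  \int[mu]_x (\sum_(i <- s) f i x) = \sum_(i <- s) \int[mu]_x f i x.
Proof.
move=> fI; rewrite /Rintegral.
under eq_integral do rewrite -sumEFin.
rewrite integral_sum//.
have ffin i : (\int[mu]_x (f i x)%:E)%E \is a fin_num.
  exact: integrable_fin_num (fI i).
elim: s => [|i s IH]; first by rewrite !big_nil.
rewrite !big_cons fineD ?IH// sum_fin_num.
by rewrite all_map; elim: [seq _ <- _ | _] => //= j r ->; rewrite ffin.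
Qed.

Variable eta : R.
Hypothesis decay : fourier_decay mu eta.

Lemma wave_integrable t : mu.-integrable setT (EFin \o wave t).
Proof.
have [/(_ t)[+ _] _] := decay; apply: eq_integrable => // x _ /=.
by rewrite cosN.
Qed.

Lemma wave_mul a b x :
  wave a x * wave b x = 2^-1 * (wave (a - b) x + wave (a + b) x).
Proof. by rewrite /= mulrBr (mulrDr (2 * pi * x)) cosB cosD; lra. Qed.

Lemma wave_mul_integrable a b :
  mu.-integrable setT (EFin \o (fun x => wave a x * wave b x)).
Proof.
pose h x := ((2^-1 : R)%:E * ((EFin \o wave (a - b)) \+ (EFin \o wave (a + b))) x)%E.
apply: (@eq_integrable _ _ _ _ _ _ h) => //.
  by move=> x _; rewrite /h /comp wave_mul.
by apply: integrableZl => //; apply: integrableD => //; exact: wave_integrable.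
Qed.

Lemma Rintegral_wave_mul a b : \int[mu]_x (wave a x * wave b x) =
  2^-1 * (\int[mu]_x wave (a - b) x + \int[mu]_x wave (a + b) x).
Proof.
rewrite -RintegralD//; try exact: wave_integrable.
rewrite -RintegralZl//; first by apply: eq_Rintegral => x _; exact: wave_mul.
exact: (integrableD measurableT (wave_integrable _) (wave_integrable _)).
Qed.

Lemma wave_small : 0 < eta -> forall e, 0 < e ->
  exists T, forall t, T <= `|t| -> `|\int[mu]_x wave t x| <= e.
Proof.
move=> eta0 e e0; have [_ [C hC]] := decay.
pose a := eta / 2; have a0 : 0 < a by rewrite /a; lra.
(* [C0] majorizes [C] and is positive; the threshold T below solves C0 T^(-a) = e. *)
pose C0 := `|C| + 1; have C0_gt0 : 0 < C0 by rewrite ltr_wpDl.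
exists ((C0 / e) `^ a^-1) => t Tt.
have -> : \int[mu]_x wave t x = complex.Re (fourier mu t).
  by rewrite /fourier/=; apply: eq_Rintegral => x _; rewrite /= cosN.
apply: (@le_trans _ _ (ComplexField.Normc.normc (fourier mu t))).
  case: (fourier mu t) => u v /=; rewrite -sqrtr_sqr ler_wsqrtr//.
  by rewrite lerDl sqr_ge0.
have base1 : 1 <= 1 + `|t| by rewrite lerDl.
have base0 : 0 < 1 + `|t| by rewrite (lt_le_trans _ base1).
apply: (le_trans (hC t)); rewrite -/a powRN.
have pw0 : 0 < (1 + `|t|) `^ a by rewrite powR_gt0.
rewrite ler_pdivrMr//.
apply: (@le_trans _ _ C0); first by rewrite (le_trans (ler_norm C))// lerDl.
rewrite mulrC -ler_pdivrMr//.
have -> : C0 / e = ((C0 / e) `^ a^-1) `^ a.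
  by rewrite -powRrM mulVf ?gt_eqF// powRr1// ltW// divr_gt0.
apply: ge0_ler_powR; rewrite ?nnegrE ?powR_ge0 ?(ltW base0) ?(ltW a0)//.
by rewrite (le_trans Tt)// lerDr.
Qed.

Lemma wave_half_measurable (l : nat -> R) :
  measurable ([set x | forall N, 1 / 2 <= wave (l N) x] : set (measurableTypeR R)).
Proof.
have -> : [set x | forall N, 1 / 2 <= wave (l N) x] =
    \bigcap_N (setT `&` [set x : measurableTypeR R | cst (1 / 2) x <= wave (l N) x]).
  apply/seteqP; split=> [x h N _ //|x h N]; first by split=> //; exact: h.
  by have [] := h N I.
apply: bigcapT_measurable => N; apply: measurable_fun_le => //.
by apply/measurable_EFinP; exact: measurable_int (wave_integrable _).
Qed.

(** Each diagonal term is at most the total mass, as |cos| <= 1. An off-diagonal term is the mean of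
    two integrals of modulus at most e, at the frequencies l_i - l_j and l_i + l_j. *)
Lemma wave_sum_second_moment (M : nat) (l : nat -> R) (e : R) :
  0 <= e ->
  (forall t i j, (i < j)%N -> (t = l i - l j \/ t = l i + l j) ->
     `|\int[mu]_x wave t x| <= e) ->
  \int[mu]_x ((\sum_(0 <= i < M) wave (l i) x) ^+ 2)
    <= M%:R * fine (mu setT) + M%:R ^+ 2 * e.
Proof.
move=> e0 small.
have smallC i j : (i != j) -> \int[mu]_x (wave (l i) x * wave (l j) x) <= e.
  wlog ij : i j / (i < j)%N.
    move=> h ne; move: (ne); rewrite neq_ltn => /orP[ij|ij]; first exact: h.
    under eq_Rintegral do rewrite mulrC.
    by apply: h => //; rewrite eq_sym.
  move=> _; rewrite Rintegral_wave_mul.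
  have := small _ _ _ ij (or_introl erefl).
  have := small _ _ _ ij (or_intror erefl).
  by rewrite !ler_norml => /andP[_ ?] /andP[_ ?]; lra.
have muT : fine (mu setT) = \int[mu]_x wave 0 x.
  by under eq_Rintegral do rewrite mulr0 cos0; rewrite Rintegral_cst// mul1r.
have diag i : \int[mu]_x (wave (l i) x * wave (l i) x) <= fine (mu setT).
  rewrite muT; apply: le_Rintegral => //; [exact: wave_mul_integrable|exact: wave_integrable|].
  move=> x _; rewrite mulr0 cos0.
  by have := cos_max (2 * pi * x * l i); rewrite ler_norml => /andP[]; nra.
have -> : \int[mu]_x ((\sum_(0 <= i < M) wave (l i) x) ^+ 2) =
  \sum_(0 <= i < M) \sum_(0 <= j < M) \int[mu]_x (wave (l i) x * wave (l j) x).
  under eq_Rintegral do rewrite expr2 mulr_suml.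
  rewrite Rintegral_sum.
    apply: eq_bigr => i _; under eq_Rintegral do rewrite mulr_sumr.
    by rewrite Rintegral_sum// => j; exact: wave_mul_integrable.
  move=> i.
  pose h x := (\sum_(0 <= j < M) (EFin \o (fun x => wave (l i) x * wave (l j) x)%R) x)%E.
  apply: (@eq_integrable _ _ _ _ _ _ h) => //.
    by move=> x _; rewrite /h /comp sumEFin mulr_sumr.
  by apply: integrable_sum => // j _; exact: wave_mul_integrable.
have mu0 : 0 <= fine (mu setT) by rewrite fine_ge0.
apply: (@le_trans _ _ (\sum_(0 <= i < M) (fine (mu setT) + M%:R * e))).
  rewrite !big_mkord; apply: ler_sum => i _.
  rewrite big_mkord (bigD1 i)//= lerD//.
  apply: (@le_trans _ _ (\sum_(j < M | j != i) e)).
    by apply: ler_sum => j ji; apply: smallC; rewrite eq_sym.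
  rewrite sumr_const -[leLHS]mulr_natl ler_wpM2r// ler_nat.
  by rewrite -[leqRHS]card_ord max_card.
by rewrite sumr_const_nat subn0 -[leLHS]mulr_natl mulrDr expr2 mulrA.
Qed.

(** On E the sum is at least M / 2; elsewhere its square is nonnegative. *)
Lemma chebyshev_wave_sum (M : nat) (l : nat -> R)
    (E : set (measurableTypeR R)) : measurable E ->
  (forall x, E x -> forall i, 1 / 2 <= wave (l i) x) ->
  (M%:R / 2) ^+ 2 * fine (mu E) <=
    \int[mu]_x ((\sum_(0 <= i < M) wave (l i) x) ^+ 2).
Proof.
move=> mE hE.
have EI : mu.-integrable setT (EFin \o (\1_E : _ -> R)).
  apply: (le_integrable _ _ _ (wave_integrable 0)) => //.
    exact/measurable_EFinP.
  move=> x _ /=; rewrite mulr0 cos0 lee_fin normr1 indicE.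
  by case: (x \in E); rewrite ?normr1 ?normr0.
have -> : fine (mu E) = \int[mu]_x (\1_E x : R).
  by rewrite /Rintegral integral_indic// setIT.
rewrite -RintegralZl//; apply: le_Rintegral => //.
- exact: (integrableZl measurableT ((M%:R / 2) ^+ 2) EI).
- pose h x := (\sum_(0 <= i < M) \sum_(0 <= j < M)
    (EFin \o (fun x => wave (l i) x * wave (l j) x)%R) x)%E.
  apply: (@eq_integrable _ _ _ _ _ _ h) => //.
    move=> x _; rewrite /h /comp expr2 mulr_suml -sumEFin; apply: eq_bigr => i _.
    by rewrite mulr_sumr -sumEFin.
  apply: integrable_sum => // i _; apply: integrable_sum => // j _.
  exact: wave_mul_integrable.
- move=> x _; rewrite indicE; case: (boolP (x \in E)) => xE; last first.
    by rewrite mulr0 sqr_ge0.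
  rewrite mulr1; have {}xE := set_mem xE.
  have le : M%:R / 2 <= \sum_(0 <= i < M) wave (l i) x.
    have -> : M%:R / 2 = \sum_(0 <= i < M) (1 / 2 : R).
      by rewrite sumr_const_nat subn0 -[RHS]mulr_natl mul1r.
    by apply: ler_sum => i _; exact: hE.
  by rewrite ler_sqr ?nnegrE// (le_trans _ le)// divr_ge0.
Qed.

Lemma unbounded_wave_negligible (l : nat -> R) : 0 < eta ->
  (forall B, exists N, B < `|l N|) ->
  mu.-negligible [set x | forall N, 1 / 2 <= wave (l N) x].
Proof.
move=> eta0 unb; set E := [set x | _].
have mE := wave_half_measurable l.
apply/negligibleP => //.
have muTfin : (mu setT < +oo)%E.
  (* At frequency 0 the wave is the constant 1, so its integrability bounds the total mass. *)
  have /integrable_fin_num := wave_integrable 0.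
  move=> /(_ measurableT); under eq_integral do rewrite /= mulr0 cos0.
  by rewrite integral_cst// mul1e ltey_eq => ->.
have Efin : mu E \is a fin_num.
  by rewrite ge0_fin_numE// (le_lt_trans _ muTfin)// le_measure// inE.
apply: contrapT => /eqP muE0.
set d := fine (mu E).
have d0 : 0 < d.
  by rewrite /d fine_gt0// lt0e muE0 measure_ge0/= ltey_eq Efin.
have e0 : 0 < d / 16 by rewrite divr_gt0.
have [T hT] := wave_small eta0 _ e0.
pose next B := proj1_sig (cid (unb B)).
have nextP B : B < `|l (next B)| by rewrite /next; case: cid.
(* Along [f] the moduli of the frequencies grow by more than |T| at each step, so sums and
   differences of two of them have modulus at least |T|. *)
pose f := fix f k := if k is k'.+1 then next (`|l (f k')| + `|T|) else 0%N.
have fS k : `|l (f k)| + `|T| < `|l (f k.+1)| by exact: nextP.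
have flt i j : (i < j)%N -> `|l (f i)| + `|T| <= `|l (f j)|.
  elim: j => // j IH; rewrite ltnS leq_eqVlt => /predU1P[->|/IH h].
    exact/ltW/fS.
  apply: le_trans h _; apply: le_trans (ltW (fS j)).
  by rewrite lerDl.
have small t i j : (i < j)%N -> (t = l (f i) - l (f j) \/ t = l (f i) + l (f j)) ->
     `|\int[mu]_x wave t x| <= d / 16.
  move=> /flt ij tE; apply: hT; apply: (le_trans (ler_norm T)).
  have {}ij : `|T| <= `|l (f j)| - `|l (f i)| by lra.
  apply: (le_trans ij); case: tE => ->; first by rewrite distrC lerB_dist.
  by have := lerB_dist (l (f j)) (- l (f i)); rewrite opprK normrN [l (f j) + _]addrC.
set m := fine (mu setT).
(* The two moment bounds give M^2 d / 4 <= M m + M^2 d / 16, which fails once M d > 16 m. *)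
have [M hM] : exists M : nat, 16 * m / d < M%:R.
  by exists (Num.truncn (16 * m / d)).+1; exact: truncnS_gt.
have m0 : 0 <= m by rewrite fine_ge0.
have M0 : 0 < M%:R :> R by rewrite (le_lt_trans _ hM)// divr_ge0 ?mulr_ge0// ltW.
have := le_trans (@chebyshev_wave_sum M (l \o f) E mE (fun x h i => h (f i)))
   (wave_sum_second_moment M (l \o f) (d / 16) (ltW e0) small).
rewrite -/d -/m => h.
have {}hM : 16 * m < M%:R * d by rewrite -ltr_pdivrMr.
have : M%:R * (16 * m) < M%:R * (M%:R * d) by rewrite ltr_pM2l.
by have := mulr_gt0 M0 (mulr_gt0 M0 d0); nra.
Qed.

End fourier_decay_moments.

(** * Convergence by telescoping majorants *)

Section telescoping.
Context {R : realType}.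
Variables S v : nat -> R.
Hypothesis v_ge0 : forall n, 0 <= v n.
Hypothesis Sv : forall n, `|S n.+1 - S n| <= v n - v n.+1.

Lemma telescoping_dist N M : (N <= M)%N -> `|S M - S N| <= v N - v M.
Proof.
move=> /subnK <-; elim: (M - N)%N => [|k IH]; first by rewrite !subrr normr0.
rewrite addSn.
have -> : S (k + N).+1 - S N = (S (k + N).+1 - S (k + N)) + (S (k + N) - S N) by ring.
by apply: le_trans (ler_normD _ _) _; have := Sv (k + N)%N; lra.
Qed.

(** S + v decreases and S - v increases, both within bounds; S is half the sum of these two
    convergent sequences. *)
Lemma telescoping_cvg : cvgn S.
Proof.
have bnd n : `|S n - S 0%N| <= v 0%N - v n by exact: telescoping_dist.
have up : cvgn (fun n => S n + v n).
  apply: nonincreasing_is_cvgn.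
    move=> m n mn; have := telescoping_dist _ _ mn; rewrite ler_norml => /andP[].
    by lra.
  exists (S 0%N - v 0%N) => _ [n _ <-].
  by have := bnd n; have := v_ge0 n; rewrite ler_norml => ? /andP[]; lra.
have down : cvgn (fun n => S n - v n).
  apply: nondecreasing_is_cvgn.
    move=> m n mn; have := telescoping_dist _ _ mn; rewrite ler_norml => /andP[].
    by lra.
  exists (S 0%N + v 0%N) => _ [n _ <-].
  by have := bnd n; have := v_ge0 n; rewrite ler_norml => ? /andP[]; lra.
have -> : S = (fun n => 2^-1 * ((S n + v n) + (S n - v n))).
  by apply/funext => n; lra.
by apply: is_cvgMr; exact: is_cvgD.
Qed.

(** Letting M tend to infinity in [telescoping_dist]; this explicit tail bound yields the O(1/N) of
    [freq_near_int]. *)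
Lemma telescoping_limit l N : S @ \oo --> l -> `|l - S N| <= v N.
Proof.
move=> Sl; have Sl' : `|S n - S N| @[n --> \oo] --> `|l - S N|.
  by apply: cvg_norm; apply: cvgB => //; exact: cvg_cst.
rewrite -(cvg_lim (@Rhausdorff R) Sl'); apply: limr_le.
  by apply/cvg_ex; exists `|l - S N|.
exists N => // n /= Nn; apply: le_trans (telescoping_dist _ _ Nn) _.
by rewrite lerBlDr lerDl.
Qed.

End telescoping.

(** * The alternating series of [log_2 n] / n *)

Section log_series.
Context {R : realType}.
Local Notation tlog := (trunc_log 2).

Lemma ipart_log2_nat n : ipart (log2 (n%:R : R)) = (tlog n)%:R.
Proof.
rewrite /ipart /log2; have [->|n0] := posnP n.
  (* At n = 0 both sides are 0, by the conventions for [ln] and [trunc_log] at 0. *)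
  by rewrite trunc_log0 ln0// mul0r floor0.
have ln2 : 0 < ln 2 :> R by rewrite ln_gt0// ltr1n.
have posn m : (0 < m)%N -> (m%:R : R) \is Num.pos by move=> ?; rewrite posrE ltr0n.
rewrite (@floor_def _ _ (tlog n)%:Z) ?pmulrn//.
have /andP[lo hi] := @trunc_log_bounds 2 n isT n0.
rewrite ler_pdivlMr// ltr_pdivrMr// -[(tlog n)%:Z + 1]/((tlog n + 1)%N%:Z) addn1.
rewrite -!pmulrn !mulr_natl -!lnXn// -!natrX.
by rewrite ler_ln ?ltr_ln ?posn ?expn_gt0// ler_nat ltr_nat lo hi.
Qed.

Lemma tlog_sqr n : (tlog n ^ 2 <= 4 * n)%N.
Proof.
have [->|n0] := posnP n; first by rewrite trunc_log0.
have /andP[lo _] := @trunc_log_bounds 2 n isT n0.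
apply: leq_trans (_ : 4 * 2 ^ tlog n <= _)%N; last by rewrite leq_mul2l.
move: (tlog n) => l {lo}.
(* The lower-order terms make the induction close: the left side at most doubles when l grows by
   1. *)
have: (l ^ 2 + 2 * l + 3 <= 4 * 2 ^ l)%N.
  by elim: l => // l IH; rewrite [(2 ^ l.+1)%N]expnS -!mulnn in IH *; lia.
by lia.
Qed.

Lemma tlog_le_sqrt n : (tlog n)%:R <= 2 * Num.sqrt n%:R :> R.
Proof.
rewrite -(@ler_sqr R) ?nnegrE// ?mulr_ge0 ?sqrtr_ge0//.
by rewrite exprMn sqr_sqrtr// -!natrX -natrM ler_nat tlog_sqr.
Qed.

(** A jump occurs only at a power of 2, and the odd one, 1, is harmless since
    [trunc_log 2 0 = 0]. *)
Lemma tlog_half n : ~~ odd n -> tlog n.+1 = tlog n.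
Proof.
case: n => [|[|n]] // en.
rewrite trunc_log2S// [RHS]trunc_log2S//; congr (trunc_log 2 _).+1.
by rewrite -[n.+3./2]/(uphalf n.+2) uphalf_half (negbTE en).
Qed.

Lemma tlog_div_cvg0 : (tlog n)%:R / n%:R @[n --> \oo] --> (0 : R).
Proof.
apply/cvgrPdist_le => e e0; near=> n.
have n0 : 0 < n%:R :> R by rewrite ltr0n; near: n; exact: nbhs_infty_gt.
have en : 4 / e ^+ 2 <= n%:R by near: n; exact: nbhs_infty_ger.
rewrite sub0r normrN ger0_norm ?divr_ge0// ler_pdivrMr//.
rewrite -ler_sqr ?nnegrE ?mulr_ge0 ?(ltW e0)//.
apply: (@le_trans _ _ (4 * n%:R)); first by rewrite -natrX -natrM ler_nat tlog_sqr.
move: en; rewrite ler_pdivrMr ?exprn_gt0// => en.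
by rewrite exprMn expr2 mulrA ler_pM2r// mulrC.
Unshelve. all: by end_near. Qed.

(* The partial sums are not monotone by blocks since [tlog] jumps at powers
   of 2, but it is constant on each pair {2m, 2m+1}. *)
Lemma alternating_tlog_cvg :
  cvgn (fun N => \sum_(1 <= n < N.+1) (-1) ^+ n * ((tlog n)%:R / n%:R) : R).
Proof.
pose S N : R := \sum_(1 <= n < N.+1) (-1) ^+ n * ((tlog n)%:R / n%:R).
pose r n : R := (tlog n)%:R / n%:R.
(* Subtracting [c n] drops an even term that is not yet paired with its odd successor. *)
pose c n : R := if odd n then 0 else r n.
have SS n : S n.+1 = S n + (-1) ^+ n.+1 * r n.+1 by rewrite /S big_nat_recr.
have c0 : c n @[n --> \oo] --> (0 : R).
  apply: (@squeeze_cvgr _ _ _ _ (fun=> 0) r); last 2 first.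
  - exact: cvg_cst.
  - exact: tlog_div_cvg0.
  apply: nearW => n; rewrite /c /r; case: odd; rewrite lexx ?divr_ge0//.
have Gcvg : cvgn (fun n => S n.+1 - c n.+1).
  (* A completed pair contributes [log_2 (n+1)] / ((n+1)(n+2)), which is O(n^(-3/2)) because the
     logarithm is at most 2 sqrt (n+1); the decrements of 4 / sqrt (n+1) have that order. *)
  apply: (@telescoping_cvg _ _ (fun n => 4 / Num.sqrt n.+1%:R)) => n.
    by rewrite divr_ge0// sqrtr_ge0.
  rewrite (SS n.+1) /c /= !negbK.
  set s : R := Num.sqrt n.+1%:R; set t : R := Num.sqrt n.+2%:R.
  have s0 : 0 < s by rewrite sqrtr_gt0 ltr0n.
  have t0 : 0 < t by rewrite sqrtr_gt0 ltr0n.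
  have s2 : s * s = n.+1%:R by rewrite -expr2 sqr_sqrtr.
  have t2 : t * t = s * s + 1 by rewrite s2 -expr2 sqr_sqrtr// -natr1.
  have st : s < t by rewrite ltr_sqrt ?ltr_nat ?ltr0n.
  have vE : 4 / s - 4 / t = 4 * (t - s) / (s * t) by field; rewrite !gt_eqF.
  have ts : t - s = (s + t)^-1.
    by apply: (mulIf (_ : s + t != 0)); rewrite ?mulVf ?gt_eqF ?addr_gt0//; lra.
  case: (boolP (odd n)) => /= on; last first.
    rewrite exprS exprS mulrA mulrNN mul1r mul1r.
    rewrite -signr_odd (negbTE on) expr0 mul1r subr0.
    have -> : S n.+1 + r n.+2 - r n.+2 - S n.+1 = 0 by ring.
    by rewrite normr0 vE divr_ge0 ?mulr_ge0 ?subr_ge0 ?ltW.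
  rewrite exprS exprS mulrA mulrNN mul1r mul1r -signr_odd on expr1 mulN1r.
  rewrite /r tlog_half /= ?negbK//.
  have -> : S n.+1 - (tlog n.+1)%:R / n.+2%:R - 0 - (S n.+1 - (tlog n.+1)%:R / n.+1%:R)
     = (tlog n.+1)%:R / ((s * s) * (t * t)).
    rewrite t2 s2 -natr1; field.
    by rewrite nat1r natr1 !pnatr_eq0.
  rewrite ger0_norm; last by rewrite divr_ge0 ?ler0n ?mulr_ge0 ?(ltW s0) ?(ltW t0).
  apply: (@le_trans _ _ (2 * s / (s * s * (t * t)))).
    by rewrite ler_pM2r ?invr_gt0 ?mulr_gt0// tlog_le_sqrt.
  rewrite vE ts.
  have -> : 2 * s / (s * s * (t * t)) = (2 / t) / (s * t) by field; rewrite !gt_eqF.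
  rewrite ler_pM2r ?invr_gt0 ?mulr_gt0//.
  rewrite ler_pdivrMr// mulrAC ler_pdivlMr ?addr_gt0//; lra.
have -> : (fun N => \sum_(1 <= n < N.+1) (-1) ^+ n * ((tlog n)%:R / n%:R)) =
    (fun n => (S n - c n) + c n) by apply/funext => n; rewrite subrK.
apply: is_cvgD; last by apply/cvg_ex; exists 0.
by have /cvg_ex[l hl] := Gcvg; apply/cvg_ex; exists l; rewrite -cvg_shiftS.
Qed.

End log_series.

(** * Convergence of the floor series *)

Lemma sum_ord_pred (V : nmodType) (K : nat) (F : nat -> V) : (0 < K)%N ->
  \sum_(k < K) F k = \sum_(k < K.-1) F k + F K.-1.
Proof. by case: K => // K _; rewrite big_ord_recr. Qed.

Section floor_series.
Context {R : realType}.
Variable K : nat.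
Hypothesis K_gt0 : (0 < K)%N.
Local Notation tlog := (trunc_log 2).

(* Exponents k < K - 1 index the series [zeta_like K x (K - k)], and k = K - 1
   indexes [gamma_like K x]. *)
Definition floor_sign k n : int := if k == K.-1 then (-1) ^+ n else 1.
Definition floor_weight k n : nat := (n ^ k * (if k == K.-1 then tlog n else 1))%N.
Definition floor_term k (x : R) n : R :=
  (floor_sign k n)%:~R *
  (ipart (n.-1`!%:R ^+ K * (floor_weight k n)%:R * x) / n`!%:R ^+ K).
(** For n >= 1, x times this is [floor_term k x n] with the floor removed. *)
Definition floor_coef k n : R :=
  (floor_sign k n)%:~R * ((floor_weight k n)%:R / n%:R ^+ K).

Lemma zeta_likeE x j : (1 < j <= K)%N ->
  zeta_like K x j = sum_from1 (floor_term (K - j)%N x).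
Proof.
move=> /andP[j1 jK]; rewrite /zeta_like; congr sum_from1; apply/funext => n.
have /negbTE kN : (K - j)%N != K.-1 by apply/eqP; lia.
by rewrite /floor_term /floor_sign /floor_weight kN mul1r muln1 natrX.
Qed.

Lemma gamma_likeE x : gamma_like K x = sum_from1 (floor_term K.-1 x).
Proof.
rewrite /gamma_like; congr sum_from1; apply/funext => n.
rewrite /floor_term /floor_sign /floor_weight eqxx ipart_log2_nat.
by rewrite rmorphXn rmorphN1 natrM natrX -!mulrA [x * _]mulrC.
Qed.

Lemma norm_floor_sign k n : `|(floor_sign k n)%:~R| = 1 :> R.
Proof.
rewrite /floor_sign; case: ifP => _; last by rewrite normr1.
by rewrite rmorphXn rmorphN1 normrX normrN1 expr1n.
Qed.

Lemma fact_exp_gt0 n : 0 < n`!%:R ^+ K :> R.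
Proof. by rewrite exprn_gt0// ltr0n fact_gt0. Qed.

Lemma floor_term_coef k x n : (0 < n)%N ->
  `|x * floor_coef k n - floor_term k x n| <= (n`!%:R ^+ K)^-1.
Proof.
case: n => // n _; rewrite /floor_coef /floor_term /ipart -pred_Sn.
set a : R := n`!%:R ^+ K * _ * x.
have nK : n.+1%:R ^+ K != 0 :> R by rewrite expf_neq0 ?pnatr_eq0.
have -> : x * ((floor_sign k n.+1)%:~R * ((floor_weight k n.+1)%:R / n.+1%:R ^+ K)) -
    (floor_sign k n.+1)%:~R * ((Num.floor a)%:~R / n.+1`!%:R ^+ K) =
    (floor_sign k n.+1)%:~R * ((a - (Num.floor a)%:~R) / n.+1`!%:R ^+ K).
  rewrite factS natrM exprMn /a; field.
  by rewrite nK gt_eqF// fact_exp_gt0.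
rewrite normrM norm_floor_sign mul1r normrM.
have qi : 0 <= (n.+1`!%:R ^+ K)^-1 :> R by rewrite invr_ge0 ltW// fact_exp_gt0.
rewrite (ger0_norm qi) ler_piMl//.
have /andP[lo hi] := floor_itv a; move: hi; rewrite intrD => hi.
by rewrite ger0_norm ?subr_ge0 ?lerBlDr// ltW// addrC.
Qed.

(** For k < K - 1 the terms are at most 1 / n^2; for k = K - 1 they are (-1)^n [log_2 n] / n, and
    convergence comes from the alternating signs. *)
Lemma floor_coef_cvg k : (k < K)%N ->
  cvgn (fun N => \sum_(1 <= n < N.+1) floor_coef k n).
Proof.
move=> kK; have [kE|kN] := eqVneq k K.-1.
  have -> : (fun N => \sum_(1 <= n < N.+1) floor_coef k n) =
      (fun N => \sum_(1 <= n < N.+1) (-1) ^+ n * ((tlog n)%:R / n%:R)).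
    apply/funext => N; rewrite !big_nat; apply: eq_bigr => n /andP[n0 _].
    rewrite /floor_coef /floor_sign /floor_weight kE eqxx rmorphXn rmorphN1.
    congr (_ * _); rewrite natrM natrX -{2}(prednK K_gt0) exprS.
    by field; rewrite expf_neq0// pnatr_eq0 -lt0n n0.
  exact: alternating_tlog_cvg.
apply: (@telescoping_cvg _ _ (fun n => 2 / n.+1%:R)) => n; first by rewrite divr_ge0.
rewrite big_nat_recr//= addrAC subrr add0r.
rewrite /floor_coef normrM norm_floor_sign mul1r.
rewrite /floor_weight (negbTE kN) muln1 natrX.
rewrite ger0_norm; last by rewrite divr_ge0// exprn_ge0.
have k2 : (k.+2 <= K)%N by lia.
apply: (@le_trans _ _ (n.+1%:R ^+ 2)^-1).
  rewrite ler_pdivrMr ?exprn_gt0 ?ltr0n//.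
  rewrite mulrC ler_pdivlMr ?exprn_gt0 ?ltr0n// -exprD addn2.
  by rewrite ler_weXn2l// ler1n.
have n1 : 1 <= n.+1%:R :> R by rewrite ler1n.
rewrite -(natr1 n.+1); move: n1; set y : R := n.+1%:R => y1.
have -> : 2 / y - 2 / (y + 1) = 2 / (y * (y + 1)).
  by field; rewrite !gt_eqF//; lra.
have y0 : 0 < y by lra.
rewrite -[leLHS]mul1r ler_pdivrMr ?exprn_gt0// mulrAC ler_pdivlMr; first by nra.
by rewrite mulr_gt0// addr_gt0.
Qed.

(** Majorant of the sum of 1 / (m!)^K over m > n; multiplied by (n!)^K it becomes 2 / (n+1). *)
Definition fact_tail n : R := 2 / (n`!%:R ^+ K * n.+1%:R).

Lemma fact_tail_ge0 n : 0 <= fact_tail n.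
Proof. by rewrite divr_ge0// mulr_ge0// ltW// fact_exp_gt0. Qed.

Lemma fact_tail_telescope n :
  (n.+1`!%:R ^+ K)^-1 <= fact_tail n - fact_tail n.+1.
Proof.
rewrite /fact_tail factS natrM exprMn -(prednK K_gt0) exprS prednK// -(natr1 n.+1).
have n1 : 1 <= n.+1%:R :> R by rewrite ler1n.
have w1 : 1 <= n.+1%:R ^+ K.-1 :> R by rewrite exprn_ege1.
have := fact_exp_gt0 n.
move: n1 w1; set y : R := n.+1%:R; set w := y ^+ _; set q := _ ^+ K => y1 w1 q0.
have y0 : 0 < y by lra.
have w0 : 0 < w by lra.
have -> : 2 / (q * y) - 2 / (y * w * q * (y + 1)) =
    (y * w * q)^-1 * (2 * w - 2 / (y + 1)).
  by field; rewrite !gt_eqF//; lra.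
rewrite ler_peMr//; first by rewrite invr_ge0 !mulr_ge0// ltW.
suff : 2 / (y + 1) <= 1 by lra.
by rewrite ler_pdivrMr; lra.
Qed.

(** The floor series is x times the coefficient series minus the series of rounding errors,
    dominated by [fact_tail]. Hence [sum_from1] is a genuine sum here, not a default value. *)
Lemma floor_term_cvg k x : (k < K)%N ->
  cvgn (fun N => \sum_(1 <= n < N.+1) floor_term k x n).
Proof.
move=> kK.
have -> : (fun N => \sum_(1 <= n < N.+1) floor_term k x n) =
    (fun N => x * (\sum_(1 <= n < N.+1) floor_coef k n) -
       \sum_(1 <= n < N.+1) (x * floor_coef k n - floor_term k x n)).
  apply/funext => N; rewrite mulr_sumr -sumrB; apply: eq_bigr => n _; ring.
apply: is_cvgB; first by apply: is_cvgMr; exact: floor_coef_cvg.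
apply: (@telescoping_cvg _ _ fact_tail) => n; first exact: fact_tail_ge0.
rewrite big_nat_recr//= addrAC subrr add0r.
exact: le_trans (floor_term_coef _ _ _ _) (fact_tail_telescope _).
Qed.

(** * Frequencies attached to an integer relation *)

Variable d : nat -> int.

(** [int_comb], [coef_sum] and [freq] are the z_n, B_N and l_N of the opening comment. *)
Definition int_comb n : int :=
  \sum_(k < K) d k * (floor_sign k n * (floor_weight k n)%:Z).
Definition coef_sum N : R :=
  \sum_(1 <= n < N.+1) (int_comb n)%:~R / n%:R ^+ K.
Definition freq N : R := N`!%:R ^+ K * (limn coef_sum - coef_sum N).

Lemma cvg_ord_comb m (u : nat -> nat -> R) (l : nat -> R) :
  (forall k, (k < m)%N -> u k @ \oo --> l k) ->
  (\sum_(k < m) (d k)%:~R * u k N) @[N --> \oo] --> \sum_(k < m) (d k)%:~R * l k.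
Proof.
elim: m => [|m IH] ul.
  by under eq_fun do rewrite big_ord0; rewrite big_ord0; exact: cvg_cst.
under eq_fun do rewrite big_ord_recr; rewrite big_ord_recr /=.
apply: cvgD; first by apply: IH => k km; apply: ul; rewrite ltnS ltnW.
by apply: cvgMr; exact: ul.
Qed.

Lemma coef_sumE N : coef_sum N =
  \sum_(k < K) (d k)%:~R * \sum_(1 <= n < N.+1) floor_coef k n.
Proof.
under [RHS]eq_bigr do rewrite mulr_sumr; rewrite exchange_big /=.
apply: eq_bigr => n _; rewrite /int_comb rmorph_sum /= mulr_suml.
by apply: eq_bigr => k _; rewrite intrM intrM /floor_coef -!mulrA pmulrn.
Qed.

Lemma coef_sum_cvg : coef_sum @ \oo --> limn coef_sum.
Proof.
have -> : coef_sum = fun N =>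
    \sum_(k < K) (d k)%:~R * \sum_(1 <= n < N.+1) floor_coef k n.
  by apply/funext => N; exact: coef_sumE.
pose u k N := \sum_(1 <= n < N.+1) floor_coef k n.
apply/cvg_ex; exists (\sum_(k < K) (d k)%:~R * limn (u k)).
by apply: (cvg_ord_comb K u (fun k => limn (u k))) => k; exact: floor_coef_cvg.
Qed.

(** Every denominator (n!)^K with n <= N divides (N!)^K. *)
Lemma fact_floor_comb_int x N :
  N`!%:R ^+ K * (\sum_(k < K) (d k)%:~R * \sum_(1 <= n < N.+1) floor_term k x n)
    \is a Num.int.
Proof.
rewrite mulr_sumr; apply: rpred_sum => k _.
rewrite mulrCA; apply: rpredM; first exact: intr_int.
rewrite mulr_sumr big_nat; apply: rpred_sum => n /andP[_ nN].
rewrite /floor_term mulrCA; apply: rpredM; first exact: intr_int.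
rewrite mulrA mulrAC; apply: rpredM; last exact: intr_int.
have /dvdnP[q ->] : (n`! %| N`!)%N.
  by rewrite -(@bin_fact N n nN) mulnCA dvdn_mulr.
by rewrite natrM exprMn mulfK ?gt_eqF ?fact_exp_gt0// -natrX natr_int.
Qed.

Lemma freq_near_int x (d0 : int) :
  \sum_(k < K) (d k)%:~R * sum_from1 (floor_term k x) + d0%:~R = 0 ->
  forall N, exists p : int,
    `|freq N * x - p%:~R| <= (\sum_(k < K) `|(d k)%:~R|) * 2 / N.+1%:R.
Proof.
move=> rel N; set C : R := \sum_(k < K) `|_|.
have C0 : 0 <= C by apply: sumr_ge0.
pose T N := \sum_(k < K) (d k)%:~R * \sum_(1 <= n < N.+1) floor_term k x n.
(* The accumulated rounding error; by the relation it tends to x B + d0, where B is the limit of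
   [coef_sum]. *)
pose E N := x * coef_sum N - T N.
have TS n : T n.+1 = T n + \sum_(k < K) (d k)%:~R * floor_term k x n.+1.
  rewrite /T -big_split; apply: eq_bigr => k _.
  by rewrite big_nat_recr//= mulrDr.
have CS n : coef_sum n.+1 = coef_sum n + \sum_(k < K) (d k)%:~R * floor_coef k n.+1.
  rewrite !coef_sumE -big_split; apply: eq_bigr => k _.
  by rewrite big_nat_recr//= mulrDr.
have Tcvg : T @ \oo --> \sum_(k < K) (d k)%:~R * sum_from1 (floor_term k x).
  pose u k N := \sum_(1 <= n < N.+1) floor_term k x n.
  by apply: (cvg_ord_comb K u (fun k => limn (u k))) => k; exact: floor_term_cvg.
have Ecvg : E @ \oo --> x * limn coef_sum + d0%:~R.
  have -> : d0%:~R = - \sum_(k < K) (d k)%:~R * sum_from1 (floor_term k x).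
    by apply/eqP; rewrite -addr_eq0 addrC rel.
  by apply: cvgB => //; apply: cvgMr; exact: coef_sum_cvg.
have Etail n : `|E n.+1 - E n| <= C * fact_tail n - C * fact_tail n.+1.
  rewrite -mulrBr /E TS CS.
  have -> : x * (coef_sum n + \sum_(k < K) (d k)%:~R * floor_coef k n.+1) -
     (T n + \sum_(k < K) (d k)%:~R * floor_term k x n.+1) - (x * coef_sum n - T n) =
     \sum_(k < K) (d k)%:~R * (x * floor_coef k n.+1 - floor_term k x n.+1).
    under [RHS]eq_bigr do rewrite mulrBr mulrCA.
    by rewrite sumrB -mulr_sumr; ring.
  apply: le_trans (ler_norm_sum _ _ _) _; rewrite mulr_suml; apply: ler_sum => k _.
  rewrite normrM ler_wpM2l//.
  exact: le_trans (floor_term_coef _ _ _ _) (fact_tail_telescope _).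
have Ct0 n : 0 <= C * fact_tail n by rewrite mulr_ge0// fact_tail_ge0.
have H := telescoping_limit _ _ Ct0 Etail _ N Ecvg.
have /intrP[m mE] := fact_floor_comb_int x N.
have q0 := fact_exp_gt0 N.
(* With this p, [freq N] x - p is (N!)^K times the tail of E after N. *)
exists (- (N`!%:Z ^+ K * d0 + m)).
rewrite rmorphN rmorphD rmorphM rmorphXn /= -mE -/(T N) /freq -pmulrn.
move: q0 H; set q := N`!%:R ^+ K => q0 H.
have -> : q * (limn coef_sum - coef_sum N) * x - - (q * d0%:~R + q * T N) =
   q * (x * limn coef_sum + d0%:~R - E N) by rewrite /E; ring.
rewrite normrM (gtr0_norm q0) mulrC -ler_pdivlMr//; apply: (le_trans H).
rewrite /fact_tail -/q le_eqVlt; apply/orP; left; apply/eqP.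
by field; rewrite nat1r pnatr_eq0 gt_eqF.
Qed.

(** The logarithmic term outgrows the others, which have degree at most K - 2, so its coefficient
    vanishes; what remains is a polynomial with too many roots. *)
Lemma int_comb_eq0 n0 : (forall n, (n0 <= n)%N -> int_comb n = 0) ->
  forall k, (k < K)%N -> d k = 0.
Proof.
move=> z0.
have split n : int_comb n = \sum_(k < K.-1) d k * n%:Z ^+ k +
    d K.-1 * ((-1) ^+ n * (n%:Z ^+ K.-1 * (tlog n)%:Z)).
  rewrite /int_comb (sum_ord_pred _ _
    (fun k => d k * (floor_sign k n * (floor_weight k n)%:Z)))//.
  rewrite {2}/floor_sign {2}/floor_weight eqxx PoszM -natz natrX natz; congr (_ + _).
  apply: eq_bigr => k _; rewrite /floor_sign /floor_weight.
  by rewrite (negbTE (_ : nat_of_ord k != K.-1)) ?ltn_eqF// mul1r muln1 -natz natrX natz.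
pose S : int := \sum_(k < K.-1) `|d k|.
have top : d K.-1 = 0.
  apply/eqP; apply: contraT => dn0.
  (* Large enough that the relation holds at n, that [log_2 n] >= 1 and that n > S. *)
  pose n := (n0 + 2 + `|S|%N)%N.
  have := z0 n _; rewrite split => /(_ _)/eqP.
  rewrite addrC addr_eq0 => /(_ _)/eqP h.
  have {}h : `|d K.-1| * (n%:Z ^+ K.-1 * (tlog n)%:Z) =
      `|\sum_(k < K.-1) d k * n%:Z ^+ k|.
    have := congr1 Num.norm (h _); rewrite normrN normrM normrM normrX normrN1 expr1n mul1r.
    rewrite (ger0_norm (_ : 0 <= n%:Z ^+ K.-1 * (tlog n)%:Z)) ?mulr_ge0 ?exprn_ge0//.
    by apply; rewrite /n; lia.
  (* The factor n avoids the exponent K - 2, a truncated subtraction when K = 1. *)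
  have le1 : n%:Z * `|\sum_(k < K.-1) d k * n%:Z ^+ k| <= S * n%:Z ^+ K.-1.
    apply: (@le_trans _ _ (n%:Z * \sum_(k < K.-1) `|d k * n%:Z ^+ k|)).
      by rewrite ler_wpM2l// ler_norm_sum.
    rewrite mulr_sumr /S mulr_suml; apply: ler_sum => k _.
    rewrite normrM mulrCA ler_wpM2l// ger0_norm ?exprn_ge0// -exprS.
    by rewrite ler_weXn2l// /n; lia.
  have npos : 0 < n%:Z ^+ K.-1 by rewrite exprn_gt0// /n; lia.
  have tl : (0 < tlog n)%N by rewrite trunc_log_gt0 /n; lia.
  move: le1; rewrite -h.
  have dpos : 1 <= `|d K.-1| by rewrite -gtz0_ge1 normr_gt0.
  have nS : S + 1 <= n%:Z by rewrite /n; lia.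
  have S0 : 0 <= S by apply: sumr_ge0.
  move: npos dpos; set w := _ ^+ _; set D := `|_| => w0 D1 bad.
  have t1 : 1 <= (tlog n)%:Z by lia.
  have : w * n%:Z <= n%:Z * (D * (w * (tlog n)%:Z)).
    have Dt : 1 <= D * (tlog n)%:Z by nia.
    have : 0 <= w * n%:Z by rewrite mulr_ge0// ltW.
    by nia.
  by nia.
have pz : \poly_(k < K.-1) d k = 0.
  apply: (@roots_geq_poly_eq0 _ _ [seq i%:Z | i <- iota n0 K.-1]).
  - apply/allP => _ /mapP[i + ->]; rewrite mem_iota => /andP[i0 _].
    by rewrite /root horner_poly; have := z0 i i0; rewrite split top mul0r addr0 => ->.
  - by rewrite map_inj_uniq ?iota_uniq// => i j [].
  - by rewrite size_map size_iota size_poly.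
move=> k kK; have [->//|kN] := eqVneq k K.-1.
have := congr1 (fun p : {poly int} => p`_k) pz; rewrite coef0 coef_poly.
by rewrite (_ : (k < K.-1)%N)//; lia.
Qed.

(** A bound B on the frequencies would give |z_{N+1}| <= 2 B ((N+1) / N!)^K < 1 for large N. The
    shift a keeps only the indices where [freq_near_int] is precise enough. *)
Lemma freq_unbounded : (exists2 k, (k < K)%N & d k != 0) ->
  forall a (B : R), exists N, B < `|freq (N + a)|.
Proof.
move=> [k kK dk] a B; apply: contrapT => hB; move/negP: dk; apply; apply/eqP.
have {}hB N : (a <= N)%N -> `|freq N| <= B.
  move=> aN; rewrite leNgt; apply/negP => h; apply: hB.
  by exists (N - a)%N; rewrite subnK.
have B0 : 0 <= B by exact: le_trans (hB a _).
have [m hm] : exists m : nat, 4 * B < m%:R.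
  by exists (Num.truncn (4 * B)).+1; exact: truncnS_gt.
apply: (@int_comb_eq0 (a + m + 5)%N) => // -[|N] hN; first by lia.
set z := int_comb N.+1.
suff : `|z%:~R| < 1 :> R by rewrite -intr_norm -[1]/(1%:~R) ltr_int; lia.
have fN := hB N ltac:(lia); have fN1 := hB N.+1 ltac:(lia).
have q0 := fact_exp_gt0 N; have q1 := fact_exp_gt0 N.+1.
have nK : 0 < N.+1%:R ^+ K :> R by rewrite exprn_gt0 ?ltr0n.
have step : z%:~R * N`!%:R ^+ K = N.+1%:R ^+ K * freq N - freq N.+1.
  have cS : coef_sum N.+1 = coef_sum N + z%:~R / N.+1%:R ^+ K.
    by rewrite /coef_sum big_nat_recr.
  rewrite /freq cS factS natrM exprMn; field.
  by rewrite gt_eqF.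
have n1 : 1 <= N.+1%:R ^+ K :> R by rewrite exprn_ege1// ler1n.
have z1 : `|z%:~R| * N`!%:R ^+ K <= 2 * B * N.+1%:R ^+ K :> R.
  rewrite -[X in _ * X](gtr0_norm q0) -normrM step.
  apply: le_trans (ler_normB _ _) _; rewrite normrM (gtr0_norm nK).
  have : N.+1%:R ^+ K * `|freq N| <= N.+1%:R ^+ K * B by rewrite ler_pM2l.
  have : B <= N.+1%:R ^+ K * B by rewrite ler_peMl.
  by lra.
(* Hence (N+1) / N! <= 2 / (N-1), and |z| <= 4 B / (N-1) < 1. *)
have fct : (N.+1 * N.-1 <= 2 * N`!)%N.
  case: N hN {z fN fN1 q0 q1 nK step n1 z1} => // -[|N]; first by lia.
  by move=> _; rewrite !factS; have := fact_gt0 N; nia.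
have N1 : 4 * B < N.-1%:R by apply: (lt_le_trans hm); rewrite ler_nat; lia.
have N2 : 2 <= N.-1%:R :> R by rewrite (ler_nat R 2); lia.
have fctR : N.+1%:R * N.-1%:R <= 2 * N`!%:R :> R by rewrite -!natrM ler_nat.
have f0 : 0 < N`!%:R :> R by rewrite ltr0n fact_gt0.
pose rho : R := N.+1%:R / N`!%:R.
have rhole : rho <= 2 / N.-1%:R.
  rewrite ler_pdivlMr; last by lra.
  by rewrite mulrAC ler_pdivrMr.
have rho0 : 0 <= rho by rewrite divr_ge0.
have rho1 : rho <= 1 by apply: (le_trans rhole); rewrite ler_pdivrMr; lra.
have rhoK : rho ^+ K <= rho.
  by rewrite -(prednK K_gt0) exprS ler_piMr// exprn_ile1.
have : `|z%:~R| <= 2 * B * rho ^+ K :> R.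
  by rewrite expr_div_n mulrA ler_pdivlMr.
move/le_lt_trans; apply.
apply: (@le_lt_trans _ _ (2 * B * (2 / N.-1%:R))).
  by rewrite ler_wpM2l ?mulr_ge0// (le_trans rhoK).
by rewrite mulrA ltr_pdivrMr; lra.
Qed.

End floor_series.

(** * Cosines near integers, and clearing denominators *)

Lemma cos_int_shift (R : realType) (y : R) (p : int) :
  cos (2 * pi * (y - p%:~R)) = cos (2 * pi * y).
Proof.
have nat_shift z n : cos (2 * pi * (z + n%:R)) = cos (2 * pi * z) :> R.
  have -> : 2 * pi * (z + n%:R) = 2 * pi * z + (pi *+ 2) *+ n.
    by rewrite mulrDr -[(pi *+ 2) *+ n]mulr_natr -[pi *+ 2]mulr_natl.
  by rewrite (periodicn (@cosD2pi R)).
case: p => n; last by rewrite NegzE mulrNz opprK -pmulrn nat_shift.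
by rewrite -pmulrn -(nat_shift _ n) subrK.
Qed.

Lemma cos_near_int (R : realType) : exists2 r : R, 0 < r &
  forall y (p : int), `|y - p%:~R| < r -> 1 / 2 <= cos (2 * pi * y).
Proof.
have : cos (2 * pi * u) @[u --> (0 : R)] --> cos (2 * pi * 0 : R).
  apply: (@continuous_comp _ _ _ (fun u : R => 2 * pi * u) cos).
    by apply: mulrl_continuous.
  exact: continuous_cos.
rewrite mulr0 cos0 => /cvgrPdist_le /(_ (1 / 2)) /(_ _)[]; first by lra.
move=> r /= r0 hr; exists r => // y p yp; rewrite -(cos_int_shift _ _ p).
have := hr (y - p%:~R); rewrite /= sub0r normrN => /(_ yp).
by rewrite ler_norml => /andP[_]; lra.
Qed.

Lemma int_common_multiple (m : nat) (c : nat -> rat) : exists2 D : int, D != 0 &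
  exists e : nat -> int, forall i, (i < m)%N -> c i * D%:~R = (e i)%:~R.
Proof.
pose D := \prod_(i < m) denq (c i); exists D.
  by apply/prodf_neq0 => i _; exact: denq_neq0.
have De i : {z : int | (i < m)%N -> c i * D%:~R = z%:~R}.
  apply: cid; have [im|_] := boolP (i < m)%N; last by exists 0.
  exists (numq (c i) * \prod_(j < m | j != Ordinal im) denq (c j)) => _.
  by rewrite intrM numqE /D (bigD1 (Ordinal im))//= intrM mulrA.
by exists (fun i => proj1_sig (De i)) => i; exact: proj2_sig (De i).
Qed.

(* The entries of the family are listed by increasing j = K - k, then k = K - 1
   and the constant 1. *)
Lemma int_relation_of_rat (R : realType) (K : nat) (K_gt0 : (0 < K)%N) (x : R) :
  ~ lin_indep_rat
      ([seq zeta_like K x j | j <- index_iota 2 K.+1] ++ [:: gamma_like K x; 1]) ->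
  exists ds : seq int, (exists2 k, (k < K)%N & ds`_k != 0) /\
    \sum_(k < K) (ds`_k)%:~R * sum_from1 (floor_term K k x) + (ds`_K)%:~R = 0.
Proof.
set s := _ ++ _ => /existsNP[c /not_implyP[rel /existsNP[i0 ci0]]].
have ss : size s = K.+1.
  by rewrite size_cat size_map size_iota /=; lia.
pose c' i := if insub i is Some j then c j else 0.
have c'E (i : 'I_(size s)) : c' i = c i by rewrite /c' valK.
have [D D0 [e eE]] := int_common_multiple K.+1 c'.
have {}rel : \sum_(i < K.+1) (e i)%:~R * s`_i = 0 :> R.
  move/(congr1 ( *%R D%:~R)): rel; rewrite mulr0 => rel'.
  rewrite -[RHS]rel' -ss mulr_sumr; apply: eq_bigr => i _.
  have iK : (i < K.+1)%N by rewrite -ss.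
  have /(congr1 (@ratr R)) := eE i iK.
  by rewrite rmorphM !ratr_int c'E => <-; ring.
have e0 : exists2 i, (i < K.+1)%N & e i != 0.
  exists i0; first by rewrite -ss.
  rewrite -(intr_eq0 rat) -eE -?ss//; rewrite c'E mulf_neq0 ?intr_eq0//.
  exact/eqP.
(* Entry i < K - 1 of the family has j = i + 2, that is k = K - 2 - i, so these coefficients are
   reversed. *)
pose d k := if (k < K.-1)%N then e (K.-1 - k.+1)%N else e k.
have relS : \sum_(k < K) (d k)%:~R * sum_from1 (floor_term K k x) + (d K)%:~R = 0.
  rewrite -[RHS]rel big_ord_recr /=; congr (_ + _); last first.
    rewrite nth_cat size_map size_iota ltnNge (_ : (K.+1 - 2 <= K)%N) ?leq_subLR ?leqnSn//=.
    rewrite (_ : (K - (K.+1 - 2))%N = 1%N) ?mulr1; last by lia.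
    by rewrite /d ltnNge leq_pred.
  rewrite (sum_ord_pred _ _ (fun k => (d k)%:~R * sum_from1 (floor_term K k x)))//.
  rewrite (sum_ord_pred _ _ (fun k => (e k)%:~R * s`_k))//; congr (_ + _).
    rewrite (reindex_inj rev_ord_inj) /=; apply: eq_bigr => i _.
    have iK := ltn_ord i.
    have -> : d (K.-1 - i.+1)%N = e i.
      by rewrite /d (_ : (_ < _)%N); [congr (e _)|]; lia.
    rewrite /s nth_cat size_map size_iota (_ : (i < K.+1 - 2)%N); last by lia.
    rewrite (nth_map 0%N) ?size_iota; last by lia.
    rewrite nth_iota; last by lia.
    rewrite zeta_likeE//; last by lia.
    by congr (_ * sum_from1 (floor_term K _ x)); lia.
  rewrite /d ltnn nth_cat size_map size_iota (_ : (K.-1 < K.+1 - 2)%N = false); last by lia.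
  by rewrite (_ : (K.-1 - (K.+1 - 2))%N = 0%N) ?gamma_likeE//; lia.
have dsE k : (k <= K)%N -> (mkseq d K.+1)`_k = d k by move=> kK; rewrite nth_mkseq.
exists (mkseq d K.+1); split; last first.
  rewrite dsE// -[RHS]relS; congr (_ + _); apply: eq_bigr => k _.
  by rewrite dsE// ltnW.
(* If all d_k with k < K vanished, the relation would force d_K = 0 too, and every e_i would be
   0. *)
apply: contrapT => no.
have dz k : (k < K)%N -> d k = 0.
  move=> kK; apply: contrapT => /eqP dk; apply: no; exists k => //.
  by rewrite dsE// ltnW.
have dK : d K = 0.
  apply/eqP; rewrite -(intr_eq0 R); move/eqP: relS.
  by rewrite big1 ?add0r// => k _; rewrite dz// mul0r.
have [i iK /negP] := e0; apply; apply/eqP.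
have [iK1|] := ltnP i K.-1.
  rewrite -(dz (K.-1 - i.+1)%N); last by lia.
  by rewrite /d (_ : (_ < _)%N); [congr (e _)|]; lia.
move=> Ki; have -> : e i = d i by rewrite /d ltnNge Ki.
by move: iK; rewrite ltnS leq_eqVlt => /predU1P[->|/dz].
Qed.

(** * Almost every x avoids all integer relations *)

Theorem theorem2 (R : realType) (K : nat) (hK : (0 < K)%N)
    (mu : {measure set (measurableTypeR R) -> \bar R})
    (hmu : radon mu) (hdim : (0 < fourier_dim mu)%E) :
  {ae mu, forall x : R,
    lin_indep_rat
      ([seq zeta_like K x j | j <- index_iota 2 K.+1] ++ [:: gamma_like K x; 1])}.
Proof.
have [_ [eta [_ decay] <-]] := ereal_sup_gt hdim; rewrite lte_fin => eta0.
pose bad (ds : seq int) : set (measurableTypeR R) := [set x : R |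
  (exists2 k, (k < K)%N & ds`_k != 0) /\
  \sum_(k < K) (ds`_k)%:~R * sum_from1 (floor_term K k x) + (ds`_K)%:~R = 0].
have bad0 ds : mu.-negligible (bad ds).
  have [dk|dk] := pselect (exists2 k, (k < K)%N & ds`_k != 0); last first.
    rewrite (_ : bad ds = set0); first exact: negligible_set0.
    by apply/seteqP; split=> x // [].
  have [r r0 hr] := cos_near_int R.
  pose C : R := \sum_(k < K) `|(ds`_k)%:~R|.
  (* From index a on, the distance of [freq N] x to the integers is below r, so all the cosines are
     at least 1/2. *)
  have [a ha] : exists a : nat, C * 2 / r < a%:R.
    by exists (Num.truncn (C * 2 / r)).+1; exact: truncnS_gt.
  have unb := @freq_unbounded R K hK (nth 0 ds) dk a.
  apply: negligibleS (unbounded_wave_negligible mu eta decay _ eta0 unb).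
  move=> x [_ rel] N /=; rewrite -mulrA [x * _]mulrC.
  have [p hp] := freq_near_int K hK _ _ _ rel (N + a)%N.
  apply: (hr _ p); apply: (le_lt_trans hp).
  rewrite ltr_pdivrMr// [r * _]mulrC -ltr_pdivrMr//; apply: (lt_le_trans ha).
  by rewrite ler_nat; lia.
(* Finite integer sequences are countable: [unpickle] enumerates the null sets [bad ds]. *)
pose F n := if unpickle n is Some ds then bad ds else set0.
apply: (@negligibleS _ _ _ _ (\bigcup_n F n)); last first.
  apply: negligible_bigcup => n; rewrite /F; case: unpickle => // *.
  exact: negligible_set0.
move=> x /= /(int_relation_of_rat _ K hK)[ds bx].
by exists (pickle ds) => //; rewrite /F pickleK.
Qed.
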